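(* Let $a<b$ be real numbers, $q\ge 1$, $n\ge 1$ integers, and let $(s_k)_{k=0}^{2n}$ be a sequence of Hermitian $q\times q$ matrices which is Hausdorff positive definite on $[a,b]$, i.e. the block Hankel matrices $H_{1,n}$ and $H_{2,n-1}$ are positive definite. Assume that the $q\times q$ matrix $I+a\,v_n^*R_n^*(a)H_{1,n}^{-1}u_{1,n}$ is invertible. Let $U^{(2n)}$, $V^{(2n)}$ be the $2q\times 2q$ resolvent matrices, and $\mathfrak J_q$, $\mathfrak D^{(2n)}$ the $2q\times2q$ matrices, defined in the context. Then $$U^{(2n)}(z)=\mathfrak J_q\,V^{(2n)}(z)\,\mathfrak J_q\,\mathfrak D^{(2n)},\qquad z\in\mathbb C .$$
   Context: All block entries are $q\times q$ complex matrices; $I$ and $0$ are identity and zero matrices of appropriate size. For a matrix function $F$ write $F^*(z):=(F(z))^*$ and $F^{*-1}(z):=((F(z))^* )^{-1}$. Moments: $s^{(1)}_j=s_j$, $s^{(2)}_j=-ab\,s_j+(a+b)s_{j+1}-s_{j+2}$, $s^{(3)}_j=b s_j-s_{j+1}$, $s^{(4)}_j=-a s_j+s_{j+1}$. For $r=1,2,3,4$: $H_{r,j}=(s^{(r)}_{k+\ell})_{k,\ell=0}^{j}$, and for $j\ge1$, $Y_{r,j}$ is the block column with entries $s^{(r)}_j,\dots,s^{(r)}_{2j-1}$. $T_j$ is the $(j+1)\times(j+1)$ block matrix with $I$ on the first block subdiagonal and $0$ elsewhere; $R_j(z)=(I-zT_j)^{-1}$; $v_j$ is the block column $(I,0,\dots,0)^{T}$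 with $j+1$ blocks; $u_j$ is the block column with entries $-s_0,\dots,-s_j$; $u_{1,j}=T_ju_j$; $u_{3,j}=-(I-bT_j)u_j$; $u_{4,j}=(I-aT_j)u_j$. For $r=3,4$ and $j\ge1$, $\Sigma_{r,j}$ is the block column consisting of $-H_{r,j-1}^{-1}Y_{r,j}$ followed by $I$. Matrix polynomials ($j\ge1$): $P_{r,j}(z)=\Sigma_{r,j}^*R_j(z)v_j$ and $Q_{r,j}(z)=\Sigma_{r,j}^*R_j(z)u_{r,j}$ for $r=3,4$. The matrices $Q_{4,n}(a)$, $P_{3,n}(a)$ and $Q_{4,n}(0)$ are invertible under the hypotheses. Resolvent matrix in the point $a$: $U^{(2n)}(z)=\begin{pmatrix} \alpha(z) & \beta(z) \\ \gamma(z) & \delta(z) \end{pmatrix}$ with $\alpha(z)=Q_{4,n}^*(\bar z)Q_{4,n}^{*-1}(a)$, $\beta(z)=\frac1{b-a}Q_{3,n}^*(\bar z)P_{3,n}^{*-1}(a)$, $\gamma(z)=(z-a)P_{4,n}^*(\bar z)Q_{4,n}^{*-1}(a)$, $\delta(z)=\frac{b-z}{b-a}P_{3,n}^*(\bar z)P_{3,n}^{*-1}(a)$. Resolvent matrix in the point $0$: put $$\widetilde V_1^{(n)}(z)=\begin{pmatrix} I+z v_n^*R_n^*(\bar z)H_{1,n}^{-1}u_{1,n} & -z v_n^*R_n^*(\bar z)H_{1,n}^{-1}v_n \\ z u_{1,n}^*R_n^*(\bar z)H_{1,n}^{-1}u_{1,n} & I-z u_{1,n}^*R_n^*(\bar z)H_{1,n}^{-1}v_n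 \end{pmatrix},$$ $\Gamma_a=(I+a v_n^*R_n^*(a)H_{1,n}^{-1}u_{1,n})^{-1}v_n^*R_n^*(a)H_{1,n}^{-1}v_n$, $\Gamma_b=(I+b v_n^*R_n^*(b)H_{1,n}^{-1}u_{1,n})^{-1}v_n^*R_n^*(b)H_{1,n}^{-1}v_n$, $M^{(2n)}=a\Gamma_a$, $N^{(2n)}=(b\Gamma_b-a\Gamma_a)^{-1}$, $$V^{(2n)}(z)=\widetilde V_1^{(n)}(z)\begin{pmatrix} I & M^{(2n)} \\ 0 & I \end{pmatrix}\begin{pmatrix} I & 0 \\ N^{(2n)} & I \end{pmatrix}.$$ Finally $\mathfrak J_q=\begin{pmatrix} 0 & I \\ I & 0 \end{pmatrix}$, $d^{(2n)}=Q_{4,n}^*(0)Q_{4,n}^{*-1}(a)$, and $\mathfrak D^{(2n)}=\begin{pmatrix} d^{(2n)} & 0 \\ 0 & ((d^{(2n)})^* )^{-1} \end{pmatrix}$.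
   Formalization: The formal theorem also assumes that I + b v_n^* R_n^*(b) H_{1,n}^{-1} u_{1,n} is invertible; without this Γ_b, and hence V^{(2n)}, is undefined (e.g. q=n=1, a=-1, b=1, s=(1,1/2,3/4)). *)

(* Defs.v *)
From mathcomp Require Import all_boot all_order all_algebra.

Set Implicit Arguments.
Unset Strict Implicit.
Unset Printing Implicit Defensive.

Import Order.TTheory GRing.Theory Num.Theory.
Local Open Scope ring_scope.
Local Open Scope sesquilinear_scope.

(* Block matrices over blocks of size q are indexed by \sum_(i < m) q, where  *)
(* m is the NUMBER of blocks (matrix.v's \mxblock and \mxcol).                *)

Definition posdefmx (C : numClosedFieldType) (m : nat) (A : 'M[C]_m) : Prop :=
  A \is hermsymmx /\
  forall x : 'cV[C]_m, x != 0 -> 0 < (x ^t* *m A *m x) 0 0.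

Section Data.
Variables (C : numClosedFieldType) (q : nat).
Implicit Types (a b z x : C) (s t : nat -> 'M[C]_q) (j m n : nat).

(* s^(2), s^(3), s^(4); s^(1) is s itself. *)
Definition mom2 a b s j : 'M[C]_q :=
  - (a * b) *: s j + (a + b) *: s j.+1 - s j.+2.
Definition mom3 b s j : 'M[C]_q := b *: s j - s j.+1.
Definition mom4 a s j : 'M[C]_q := - a *: s j + s j.+1.

(* hankel t m has m x m blocks: H_{r,j} is hankel s^(r) j.+1, and for         *)
(* 0 < j the matrix H_{r,j-1} is hankel s^(r) j.                              *)
Definition hankel t m : 'M[C]_(\sum_(i < m) q) :=
  \mxblock_(k < m, l < m) t (k + l)%N.

Definition hausdorff_posdef a b s n : Prop :=
  posdefmx (hankel s n.+1) /\ posdefmx (hankel (mom2 a b s) n).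

Definition Ymx t j : 'M[C]_(\sum_(i < j) q, q) := \mxcol_(k < j) t (j + k)%N.

Definition Tmx j : 'M[C]_(\sum_(i < j.+1) q) :=
  \mxblock_(k < j.+1, l < j.+1) (if k == l.+1 :> nat then 1%:M else 0 : 'M[C]_q).

Definition Rmx j z : 'M[C]_(\sum_(i < j.+1) q) := invmx (1%:M - z *: Tmx j).

Definition vmx j : 'M[C]_(\sum_(i < j.+1) q, q) :=
  \mxcol_(k < j.+1) (if k == 0 :> nat then 1%:M else 0 : 'M[C]_q).

Definition umx s j : 'M[C]_(\sum_(i < j.+1) q, q) := \mxcol_(k < j.+1) - s k.

Definition u1mx s j := Tmx j *m umx s j.
Definition u3mx b s j := - ((1%:M - b *: Tmx j) *m umx s j).
Definition u4mx a s j := (1%:M - a *: Tmx j) *m umx s j.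

(* The last block (index ord_max) is I; the first j ones are those of         *)
(* - H_{r,j-1}^{-1} Y_{r,j}, with t := s^(r).                                 *)
Definition Sigma t j : 'M[C]_(\sum_(i < j.+1) q, q) :=
  \mxcol_(k < j.+1)
    (if unlift ord_max k is Some i
     then submxcol (- (invmx (hankel t j) *m Ymx t j)) i
     else 1%:M).

Definition P3 b s j z := (Sigma (mom3 b s) j) ^t* *m Rmx j z *m vmx j.
Definition Q3 b s j z := (Sigma (mom3 b s) j) ^t* *m Rmx j z *m u3mx b s j.
Definition P4 a s j z := (Sigma (mom4 a s) j) ^t* *m Rmx j z *m vmx j.
Definition Q4 a s j z := (Sigma (mom4 a s) j) ^t* *m Rmx j z *m u4mx a s j.

(* F^*(conj z) is the adjoint of F (conj z), and F^{*-1}(a) is the inverse    *)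
(* of the adjoint of F a.                                                     *)

Definition Umx a b s n z : 'M[C]_(q + q) :=
  block_mx
    ((Q4 a s n z^*) ^t* *m invmx ((Q4 a s n a) ^t*))
    ((b - a)^-1 *: ((Q3 b s n z^*) ^t* *m invmx ((P3 b s n a) ^t*)))
    ((z - a) *: ((P4 a s n z^*) ^t* *m invmx ((Q4 a s n a) ^t*)))
    (((b - z) / (b - a)) *: ((P3 b s n z^*) ^t* *m invmx ((P3 b s n a) ^t*))).

Definition V1tilde s n z : 'M[C]_(q + q) :=
  let Hi := invmx (hankel s n.+1) in
  let v := vmx n in
  let u1 := u1mx s n in
  let Rs := (Rmx n z^*) ^t* in
  block_mx
    (1%:M + z *: (v ^t* *m Rs *m Hi *m u1))
    (- (z *: (v ^t* *m Rs *m Hi *m v)))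
    (z *: (u1 ^t* *m Rs *m Hi *m u1))
    (1%:M - z *: (u1 ^t* *m Rs *m Hi *m v)).

(* The matrix whose inverse enters Gamma_x (x = a, b). *)
Definition Gamma_den s n x : 'M[C]_q :=
  1%:M + x *: ((vmx n) ^t* *m (Rmx n x) ^t* *m invmx (hankel s n.+1)
                 *m u1mx s n).

Definition Gamma s n x : 'M[C]_q :=
  invmx (Gamma_den s n x)
    *m ((vmx n) ^t* *m (Rmx n x) ^t* *m invmx (hankel s n.+1) *m vmx n).

Definition Mmx a s n : 'M[C]_q := a *: Gamma s n a.
Definition Nmx a b s n : 'M[C]_q :=
  invmx (b *: Gamma s n b - a *: Gamma s n a).

Definition Vmx a b s n z : 'M[C]_(q + q) :=
  V1tilde s n z *m block_mx 1%:M (Mmx a s n) 0 1%:M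
                *m block_mx 1%:M 0 (Nmx a b s n) 1%:M.

Definition Jmx : 'M[C]_(q + q) := block_mx 0 1%:M 1%:M 0.

Definition dmx a s n : 'M[C]_q := (Q4 a s n 0) ^t* *m invmx ((Q4 a s n a) ^t*).

Definition Dmx a s n : 'M[C]_(q + q) :=
  block_mx (dmx a s n) 0 0 (invmx ((dmx a s n) ^t*)).

End Data.

Arguments Jmx {C q}.

(* Main.v *)
(* Write X = H_{1,n}^{-1}, M' for the adjoint of M, R(z) = (I - z T)^{-1},     *)
(* Rs(z) = (I - z T')^{-1}, and A, B, C, D for the blocks of V~_1. The column  *)
(* H S, where S is Sigma_{4,n} (resp. Sigma_{3,n}), is killed by the           *)
(* difference operator y_{k+1} - x y_k with x = a (resp. x = b), so            *)
(* S = X R(x) v c with c invertible. The Lyapunov identity                     *)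
(* T H - H T' = v u_1' - u_1 v' yields Christoffel-Darboux formulas expressing *)
(* v' Rs(z) X R(x) v and u' (I - x T') Rs(z) X R(x) v bilinearly in A, B, C, D *)
(* at z and at x. Hence, with M_x = x Gamma_x, the adjoints of P and Q         *)
(* attached to x are, up to sign and the factor z - x, the columns A M_x + B   *)
(* and C M_x + D times A(x)' c; in particular d^{(2n)} = A(a)'. Finally        *)
(* (b - a) P_{3,n}(a)' = A(a) (M_b - M_a) A(b)' c, and P_{3,n}(a) is           *)
(* invertible because H_{2,n-1} is, so N^{(2n)} is a genuine inverse.          *)

Require Import Defs.
From mathcomp Require Import all_boot all_order all_algebra.
From mathcomp Require Import reals complex.
From mathcomp Require Import ring.

Set Implicit Arguments.
Unset Strict Implicit.
Unset Printing Implicit Defensive.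

Import Order.TTheory GRing.Theory Num.Theory.
Local Open Scope ring_scope.
Local Open Scope sesquilinear_scope.

(** Both resolvent matrices come from the kernel [Rs z *m X *m R w]. Freezing w at an endpoint x
    gives, on the one hand, the adjoints of P and Q attached to x, up to constant right factors
    ([Sigma_resolvent]). On the other hand, the displacement structure of H ([hankel_lyapunov])
    expresses the same functions through the blocks of V~_1 ([christoffel_darboux_v],
    [christoffel_darboux_u]). Trading B(x)' for - M_x A(x)' ([VB_adj_Gamma]) leaves the columns A
    M_x + B and C M_x + D ([P_adjE], [Q_adjE]).

    The first block column of U uses x = a and the second x = b. The factors with M and N in V make
    the same change of columns: with N = (M_b - M_a)^{-1}, one has C + (C M_a + D) N = (C M_b + D)
    N, and likewise for A and B ([mulmx_column_shift]). The normalisations at a and 0 then leave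
    exactly diag(A(a)', A(a)^{-1}) on the right. *)

Section Adjoint.
Context {C : numClosedFieldType}.

(** * Adjoints and positive definiteness *)

Lemma adjmxM m n p (A : 'M[C]_(m, n)) (B : 'M_(n, p)) :
  (A *m B)^t* = B^t* *m A^t*.
Proof. by rewrite trmx_mul map_mxM. Qed.

Lemma adjmxD m n (A B : 'M[C]_(m, n)) : (A + B)^t* = A^t* + B^t*.
Proof. by rewrite linearD /= map_mxD. Qed.

Lemma adjmxN m n (A : 'M[C]_(m, n)) : (- A)^t* = - A^t*.
Proof. by rewrite linearN /= map_mxN. Qed.

Lemma adjmxB m n (A B : 'M[C]_(m, n)) : (A - B)^t* = A^t* - B^t*.
Proof. by rewrite adjmxD adjmxN. Qed.

Lemma adjmxZ m n x (A : 'M[C]_(m, n)) : (x *: A)^t* = x^* *: A^t*.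
Proof. by rewrite linearZ /= map_mxZ. Qed.

Lemma adjmx1 m : (1%:M : 'M[C]_m)^t* = 1%:M.
Proof. by rewrite trmx1 map_mx1. Qed.

Lemma adjmx0 m n : (0 : 'M[C]_(m, n))^t* = 0.
Proof. by rewrite trmx0 map_mx0. Qed.

Lemma adjmxV m (A : 'M[C]_m) : (invmx A)^t* = invmx (A^t*).
Proof. by rewrite trmx_inv map_invmx. Qed.

Lemma unitmx_adj m (A : 'M[C]_m) : (A^t* \in unitmx) = (A \in unitmx).
Proof. by rewrite map_unitmx unitmx_tr. Qed.

Lemma hermsymmxP m (A : 'M[C]_m) : reflect (A^t* = A) (A \is hermsymmx).
Proof.
by rewrite is_hermitianmxE expr0 scale1r eq_sym; apply: eqP.
Qed.

Lemma unitmx_inj_col m (A : 'M[C]_m) :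
  (forall x : 'cV_m, A *m x = 0 -> x = 0) -> A \in unitmx.
Proof.
move=> Ainj; rewrite -unitmx_tr -row_free_unit; apply/inj_row_free => v vA0.
apply: trmx_inj; rewrite trmx0; apply: Ainj.
by apply: trmx_inj; rewrite trmx_mul trmxK trmx0.
Qed.

Lemma posdefmx_unit m (A : 'M[C]_m) : posdefmx A -> A \in unitmx.
Proof.
case=> _ Apos; apply: unitmx_inj_col => x Ax0; apply/eqP/negPn/negP => /Apos.
by rewrite -mulmxA Ax0 mulmx0 mxE ltxx.
Qed.

Lemma posdefmx_ge0 m (A : 'M[C]_m) (x : 'cV_m) :
  posdefmx A -> 0 <= (x^t* *m A *m x) 0 0.
Proof.
case=> _ Apos; have [->|/Apos/ltW//] := eqVneq x 0.
by rewrite mulmx0 mxE.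
Qed.

(** On a kernel vector of K the form of Y A Y' + B vanishes, although it is a nonnegative term plus
    a positive one. This serves the Hankel matrices of s^(3) and s^(4), about which positivity is
    only known indirectly. *)
Lemma unitmx_congr_posdef m p (A : 'M[C]_m) (B K : 'M_p) (Y : 'M_(p, m)) k :
  posdefmx A -> posdefmx B -> k *: K = Y *m A *m Y^t* + B -> K \in unitmx.
Proof.
move=> A_pos B_pos KE; apply: unitmx_inj_col => x Kx0.
apply/eqP/negPn/negP => x_neq0.
have := ltr_wpDl (posdefmx_ge0 (Y^t* *m x) A_pos) (B_pos.2 x x_neq0).
have := congr1 (fun M => (x^t* *m M *m x) 0 0) KE.
rewrite -scalemxAr -scalemxAl -!mulmxA Kx0 mulmx0 scaler0 mxE adjmxM trmxCK.
by rewrite mulmxDl mulmxDr !mulmxA mxE => <-; rewrite ltxx.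
Qed.

End Adjoint.

(** * Block calculus for shifts, Hankel matrices and Sigma *)

Section Blocks.
Variables (C : numClosedFieldType) (q : nat).
Implicit Types (s t : nat -> 'M[C]_q) (F : nat -> nat -> 'M[C]_q).

(** Blocks are indexed by naturals rather than ordinals, so that indices can be shifted without
    casts. *)
Definition bmx m p F : 'M[C]_(\sum_(i < m) q, \sum_(i < p) q) :=
  \mxblock_(k < m, l < p) F k l.

(* Deletes the last block if d = 0 and the first one if d = 1. *)
Definition shiftmx d m : 'M[C]_(\sum_(i < m) q, \sum_(i < m.+1) q) :=
  bmx m m.+1 (fun k l => if l == (d + k)%N then 1%:M else 0).

Lemma bmxM m n p F G :
  bmx m n F *m bmx n p G = bmx m p (fun k l => \sum_(i < n) F k i *m G i l).
Proof. exact: mul_mxblock. Qed.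

Lemma eq_bmx m p F G :
  (forall k l, (k < m)%N -> (l < p)%N -> F k l = G k l) ->
  bmx m p F = bmx m p G.
Proof. by move=> eqFG; apply: eq_mxblock => k l; apply: eqFG. Qed.

Lemma bmx_adj m p F : (bmx m p F)^t* = bmx p m (fun k l => (F l k)^t*).
Proof. by rewrite tr_mxblock; apply/matrixP => i j; rewrite !mxE. Qed.

Lemma bmxD m p F G : bmx m p F + bmx m p G = bmx m p (fun k l => F k l + G k l).
Proof. by apply/matrixP => i j; rewrite !mxE. Qed.

Lemma sum_delta_mulmx p n c (G : nat -> 'M[C]_(q, p)) : (c < n)%N ->
  \sum_(i < n) (if i == c :> nat then 1%:M else 0 : 'M[C]_q) *m G i = G c.
Proof.
move=> lt_cn; rewrite (bigD1 (Ordinal lt_cn)) //= eqxx mul1mx big1 ?addr0 //.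
by move=> i; rewrite -val_eqE /= => /negPf ->; rewrite mul0mx.
Qed.

Lemma bmx1 m : bmx m m (fun k l => if l == k then 1%:M else 0) = 1%:M.
Proof.
(* It is enough that the left side fixes every A by multiplication; this avoids comparing it with
   the identity entry by entry. *)
rewrite -[LHS]mulmx1; move: (1%:M : 'M_(\sum_(i < m) q)) => A.
rewrite -(submxblockK A) mul_mxblock; apply: eq_mxblock => k l.
rewrite (bigD1 k) //= eqxx mul1mx big1 ?addr0 // => i.
by rewrite -val_eqE /= => /negPf ->; rewrite mul0mx.
Qed.

Lemma shiftmxM d m p F : (d <= 1)%N ->
  shiftmx d m *m bmx m.+1 p F = bmx m p (fun k l => F (d + k)%N l).
Proof.
move=> le_d1; rewrite bmxM; apply: eq_bmx => k l lt_km _.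
rewrite (sum_delta_mulmx (F^~ l)) //.
by rewrite ltnS (leq_trans (leq_add le_d1 (leqnn k))).
Qed.

Lemma mulmx_shift_adj d m p F : (d <= 1)%N ->
  bmx p m.+1 F *m (shiftmx d m)^t* = bmx p m (fun k l => F k (d + l)%N).
Proof.
move=> le_d1; rewrite -[LHS]trmxCK adjmxM trmxCK bmx_adj shiftmxM // bmx_adj.
by apply: eq_bmx => k l _ _; rewrite trmxCK.
Qed.

Lemma vmx_adj m :
  (vmx C q m)^t* = \mxrow_(k < m.+1) (if k == 0 :> nat then 1%:M else 0).
Proof.
rewrite tr_mxcol; apply/matrixP => i j; rewrite !mxE.
by case: ifP => _; rewrite !mxE ?rmorph0 // rmorph_nat eq_sym.
Qed.

Lemma vmx_adj_mxcol m p (G : nat -> 'M[C]_(q, p)) :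
  (vmx C q m)^t* *m \mxcol_(k < m.+1) G k = G 0%N.
Proof. by rewrite vmx_adj mul_mxrow_mxcol sum_delta_mulmx. Qed.

Lemma vmx_adjM m p F :
  (vmx C q m)^t* *m bmx m.+1 p F = \mxrow_(l < p) F 0%N l.
Proof.
rewrite vmx_adj mul_mxrow_mxblock; apply: eq_mxrow => l.
by rewrite (sum_delta_mulmx (F^~ l)).
Qed.

Lemma vmx_adj_vmx m : (vmx C q m)^t* *m vmx C q m = 1%:M.
Proof. by rewrite (vmx_adj_mxcol _ (fun k => if k == 0%N then _ else _)). Qed.

Lemma TmxE m :
  Tmx C q m = bmx m.+1 m.+1 (fun k l => if k == l.+1 then 1%:M else 0).
Proof. by []. Qed.

Lemma vmx_adj_Tmx m : (vmx C q m)^t* *m Tmx C q m = 0.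
Proof. by rewrite TmxE vmx_adjM; apply: mxrow0. Qed.

Lemma shiftmx_Tmx m : shiftmx 1 m *m Tmx C q m = shiftmx 0 m.
Proof.
rewrite TmxE shiftmxM //; apply: eq_bmx => k l _ _.
by rewrite add1n eqSS eq_sym.
Qed.

(** The two summands are the complementary projections onto the first block and onto the remaining
    ones. *)
Lemma vmx_shiftmx_decomp m :
  vmx C q m *m (vmx C q m)^t* + (shiftmx 1 m)^t* *m shiftmx 1 m = 1%:M.
Proof.
rewrite vmx_adj mul_mxcol_mxrow bmx_adj bmxM.
rewrite -/(bmx m.+1 m.+1 (fun k l =>
  (if k == 0%N then 1%:M else 0) *m (if l == 0%N then 1%:M else 0))).
rewrite bmxD -bmx1; apply: eq_bmx => -[|k] l lt_km _ /=.
  rewrite mul1mx big1 ?addr0 // => i _.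
  by rewrite trmx0 map_mx0 mul0mx.
rewrite mul0mx add0r -(sum_delta_mulmx (c := k)
  (fun i => if l == i.+1 then 1%:M else 0) lt_km).
apply: eq_bigr => i _; rewrite add1n eqSS eq_sym.
by case: eqP => // _; rewrite ?adjmx1 // adjmx0.
Qed.

Lemma vmx_shiftmx_split m p (y : 'M_(_, p)) :
  y = vmx C q m *m ((vmx C q m)^t* *m y)
      + (shiftmx 1 m)^t* *m (shiftmx 1 m *m y).
Proof. by rewrite !mulmxA -mulmxDl vmx_shiftmx_decomp mul1mx. Qed.

Lemma Tmx_trig m : is_trig_mx (Tmx C q m).
Proof.
apply/is_trig_mxblockP; split=> [k l lt_kl|k].
  by rewrite ifN // neq_ltn ltnS (ltnW lt_kl).
by rewrite ifN ?mx0_is_trig // neq_ltn ltnSn.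
Qed.

(** T is strictly lower triangular, so the determinant is 1 and [Rmx] is a genuine inverse at every
    z. *)
Lemma one_subZ_Tmx_unit m z : 1%:M - z *: Tmx C q m \in unitmx.
Proof.
rewrite unitmxE det_trig; last first.
  apply/is_trig_mxP => i j lt_ij; rewrite !mxE.
  move/is_trig_mxP: (Tmx_trig m) => /(_ i j lt_ij); rewrite !mxE => ->.
  by rewrite mulr0 subr0 -val_eqE ltn_eqF.
rewrite big1 ?unitr1 // => i _; rewrite !mxE eqxx ifN ?mxE ?mulr0 ?subr0 //.
by rewrite neq_ltn ltnSn.
Qed.

Lemma hankelE t m : hankel t m = bmx m m (fun k l => t (k + l)%N).
Proof. by []. Qed.

(* The block row [H_{r,m-1}, Y_{r,m}] when t = s^(r). *)
Definition hankel1 t m := bmx m m.+1 (fun k l => t (k + l)%N).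

Lemma umxE s m : umx s m = - (hankel s m.+1 *m vmx C q m).
Proof.
apply/eqP; rewrite -addr_eq0; apply/eqP.
rewrite mul_mxblock_mxrow /umx -mxcolD -[RHS]mxcol0; apply: eq_mxcol => k.
rewrite (bigD1 ord0) //= mulmx1 addn0 big1 ?addr0 ?addNr // => i.
by rewrite -val_eqE /= => /negPf ->; rewrite mulmx0.
Qed.

(** The upper blocks of Sigma solve H x = - Y, and its last block I contributes + Y. *)
Lemma hankel1_Sigma t m : hankel t m \in unitmx -> hankel1 t m *m Sigma t m = 0.
Proof.
move=> Ht; rewrite mul_mxblock_mxrow -[RHS]mxcol0.
apply: eq_mxcol => k; rewrite big_ord_recr /= unlift_none mulmx1.
rewrite (eq_bigr (fun i : 'I_m =>
  t (k + i)%N *m submxcol (- (invmx (hankel t m) *m Ymx t m)) i)); last first.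
  move=> i _; have -> : widen_ord (leqnSn m) i = lift ord_max i.
    by apply: val_inj; rewrite /= /bump leqNgt ltn_ord.
  by rewrite liftK.
have : submxcol (hankel t m *m - (invmx (hankel t m) *m Ymx t m)) k
       = - t (k + m)%N.
  rewrite mulmxN mulKVmx // submxcolN mxcolK addnC //.
rewrite -{1}[- (_ *m _)]submxcolK mul_mxblock_mxrow mxcolK => ->.
by rewrite addNr.
Qed.

Lemma Sigma_inj t m p (x : 'M[C]_(q, p)) : Sigma t m *m x = 0 -> x = 0.
Proof.
move=> /(congr1 (fun A => submxcol A ord_max)).
by rewrite -submxcol_mul mxcolK unlift_none mul1mx submxcol0.
Qed.

End Blocks.

(** * Christoffel-Darboux formulas from a Lyapunov identity *)

Section Kernel.
Variables (C : numClosedFieldType) (q N : nat).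
Variables (H T : 'M[C]_N) (v u : 'M[C]_(N, q)).
Hypothesis H_unit : H \in unitmx.
Hypothesis H_herm : H^t* = H.
Hypothesis T_unit : forall z, 1%:M - z *: T \in unitmx.
Hypothesis vv : v^t* *m v = 1%:M.
Hypothesis vT : v^t* *m T = 0.
Hypothesis uE : u = - (H *m v).
Hypothesis lyapunov :
  T *m H - H *m T^t* = v *m (T *m u)^t* - T *m u *m v^t*.

Local Notation u1 := (T *m u).
Local Notation X := (invmx H).
Local Notation R z := (invmx (1%:M - z *: T)).
Local Notation Rs z := ((R z^*)^t*).

Lemma resolvent_adjVmx z : Rs z *m (1%:M - z *: T^t*) = 1%:M.
Proof.
rewrite -[X in _ *m X]trmxCK adjmxB adjmx1 adjmxZ trmxCK -adjmxM mulmxV //.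
exact: adjmx1.
Qed.

(** Conjugating the Lyapunov identity by X gives the commutator X T - T' X. It is the correction
    needed to write (z - w) X through X (I - w T) and (I - z T') X, each of which cancels one
    resolvent. *)
Lemma resolvent_kernel z w :
  (z - w) *: (Rs z *m X *m R w) =
  z *: (Rs z *m X) - w *: (X *m R w)
  + (z * w) *: (Rs z *m X *m (v *m u1^t* - u1 *m v^t*) *m X *m R w).
Proof.
have XDX : X *m (v *m u1^t* - u1 *m v^t*) *m X = X *m T - T^t* *m X.
  by rewrite -lyapunov mulmxBr mulmxBl mulmxA mulmxK // mulKmx.
have key : (z - w) *: X = z *: (X *m (1%:M - w *: T))
    - w *: ((1%:M - z *: T^t*) *m X) + (z * w) *: (X *m T - T^t* *m X).
  rewrite mulmxBr mulmxBl mulmx1 mul1mx -scalemxAr -scalemxAl.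
  by apply/matrixP => i j; rewrite !mxE; ring.
have distr (P Q S : 'M_N) : Rs z *m (P - Q + S) *m R w
    = Rs z *m P *m R w - Rs z *m Q *m R w + Rs z *m S *m R w.
  by rewrite mulmxDr mulmxDl [_ *m (P - Q)]mulmxBr [(_ - _) *m R w]mulmxBl.
rewrite scalemxAl scalemxAr key distr.
rewrite -!(scalemxAr, scalemxAl) -!mulmxA mulmxV // mulmx1.
rewrite !mulmxA resolvent_adjVmx mul1mx -XDX.
by rewrite !mulmxA.
Qed.

Definition VA z : 'M[C]_q := 1%:M + z *: (v^t* *m Rs z *m X *m u1).
Definition VB z : 'M[C]_q := - (z *: (v^t* *m Rs z *m X *m v)).
Definition VC z : 'M[C]_q := z *: (u1^t* *m Rs z *m X *m u1).
Definition VD z : 'M[C]_q := 1%:M - z *: (u1^t* *m Rs z *m X *m v).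

Lemma invH_herm : X^t* = X.
Proof. by rewrite adjmxV H_herm. Qed.

Lemma VA_adj w : w^* = w ->
  (VA w)^t* = 1%:M + w *: (u1^t* *m (X *m (R w *m v))).
Proof.
by move=> w_real; rewrite adjmxD adjmx1 adjmxZ !adjmxM !trmxCK invH_herm w_real.
Qed.

Lemma VB_adj w : w^* = w -> (VB w)^t* = - (w *: (v^t* *m (X *m (R w *m v)))).
Proof.
by move=> w_real; rewrite adjmxN adjmxZ !adjmxM !trmxCK invH_herm w_real.
Qed.

Lemma mulmx_resolvent_kernel z w p (x : 'M_(p, N)) :
  (z - w) *: (x *m Rs z *m X *m R w *m v) =
  z *: (x *m Rs z *m X *m v) - w *: (x *m (X *m (R w *m v)))
  + (z * w) *: (x *m Rs z *m X *m v *m (u1^t* *m (X *m (R w *m v)))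
                - x *m Rs z *m X *m u1 *m (v^t* *m (X *m (R w *m v)))).
Proof.
have := congr1 (fun A => x *m A *m v) (resolvent_kernel z w).
rewrite -!scalemxAr -!scalemxAl !mulmxA => ->.
rewrite ![x *m (_ + _)]mulmxDr ![_ *m (_ - _)]mulmxBr ![(_ + _) *m _]mulmxDl.
rewrite !mulmxN !mulNmx -!scalemxAr -!scalemxAl !mulmxA.
by rewrite !mulmxBr !mulmxBl !mulmxA.
Qed.

Lemma christoffel_darboux_v z w : w^* = w ->
  (z - w) *: (v^t* *m Rs z *m X *m R w *m v) =
  VA z *m (VB w)^t* - VB z *m (VA w)^t*.
Proof.
move=> w_real; rewrite VA_adj // VB_adj // mulmx_resolvent_kernel /VA /VB.
move: (v^t* *m Rs z *m X *m v) (v^t* *m Rs z *m X *m u1) => x g.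
move: (u1^t* *m _) (v^t* *m _) => k h.
rewrite mulmxDl !mulNmx !mulmxN !mulmxDr !mul1mx mulmx1.
rewrite -!(scalemxAr, scalemxAl).
move: (x *m k) (g *m h) => xk gh.
by apply/matrixP => i j; rewrite !mxE; ring.
Qed.

Lemma christoffel_darboux_u1 z w : w^* = w ->
  (z - w) *: (u1^t* *m Rs z *m X *m R w *m v) =
  1%:M - VD z *m (VA w)^t* + VC z *m (VB w)^t*.
Proof.
move=> w_real; rewrite VA_adj // VB_adj // mulmx_resolvent_kernel /VC /VD.
move: (u1^t* *m Rs z *m X *m v) (u1^t* *m Rs z *m X *m u1) => x g.
move: (u1^t* *m (X *m _)) (v^t* *m _) => k h.
rewrite mulmxBl mul1mx !mulmxN mulmxDr mulmx1 -!(scalemxAr, scalemxAl).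
move: (x *m k) (g *m h) => xk gh.
by apply/matrixP => i j; rewrite !mxE; ring.
Qed.

(** At z = w the left side of the Christoffel-Darboux formula vanishes; this and the next lemma are
    the symplectic relations of V~_1 at a real point. *)
Lemma VA_VB_adj w : w^* = w -> VA w *m (VB w)^t* = VB w *m (VA w)^t*.
Proof.
move=> w_real; apply/eqP; rewrite -subr_eq0 -christoffel_darboux_v //.
by rewrite subrr scale0r.
Qed.

Lemma VD_VA_adj w : w^* = w -> VC w *m (VB w)^t* - VD w *m (VA w)^t* = - 1%:M.
Proof.
move=> w_real; apply/eqP; rewrite -addr_eq0 addrC addrA addrAC.
by rewrite -christoffel_darboux_u1 // subrr scale0r.
Qed.

Lemma vR w : v^t* *m R w = v^t*.
Proof.
have vI : v^t* *m (1%:M - w *: T) = v^t*.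
  by rewrite mulmxBr mulmx1 -scalemxAr vT scaler0 subr0.
by rewrite -{1}vI mulmxK.
Qed.

Lemma christoffel_darboux_u z w : w^* = w ->
  ((1%:M - w *: T) *m u)^t* *m Rs z *m X *m R w *m v =
  VC z *m (VB w)^t* - VD z *m (VA w)^t*.
Proof.
move=> w_real.
(* Moving the parameter from w to z makes the first summand cancel [Rs z], leaving the constant - I.
   This constant absorbs the I of the formula for u1, so no factor z - w survives. *)
have -> : ((1%:M - w *: T) *m u)^t* = u^t* *m (1%:M - z *: T^t*)
    + (z - w) *: u1^t*.
  rewrite !adjmxM adjmxB adjmx1 adjmxZ w_real !mulmxBr mulmx1 -!scalemxAr.
  by rewrite scalerBl addrA subrK.
have uX : u^t* *m X = - v^t*.
  by rewrite uE adjmxN adjmxM H_herm mulNmx mulmxK.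
transitivity (- 1%:M + (z - w) *: (u1^t* *m Rs z *m X *m R w *m v)).
  rewrite !mulmxDl -!scalemxAl -[_ *m _ *m Rs z]mulmxA.
  by rewrite (mulmx1C (resolvent_adjVmx z)) mulmx1 uX !mulNmx vR vv.
by rewrite christoffel_darboux_u1 // addrA addKr addrC.
Qed.

End Kernel.

Lemma mulmx_column_shift (K : fieldType) q (e f g h U W : 'M[K]_q) :
  U \in unitmx -> g - h \in unitmx ->
  (e + (e *m h + f) *m invmx (g - h)) *m invmx U *m (U *m (g - h) *m W) =
  (e *m g + f) *m W.
Proof.
move=> U_unit gh_unit; rewrite -!mulmxA mulKmx // !mulmxA; congr (_ *m W).
by rewrite [(e + _) *m _]mulmxDl mulmxKV // mulmxBr addrA subrK.
Qed.

(** * The Hankel data: Lyapunov identity, Sigma and invertibility *)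

Section Resolvent.
Variables (C : numClosedFieldType) (q n : nat) (s : nat -> 'M[C]_q) (a b : C).
Hypothesis lt_ab : a < b.
Hypothesis a_real : a^* = a.
Hypothesis b_real : b^* = b.
Hypothesis s_posdef : hausdorff_posdef a b s n.

Local Notation H := (hankel s n.+1).
Local Notation T := (Tmx C q n).
Local Notation v := (vmx C q n).
Local Notation u := (umx s n).
Local Notation S := (shiftmx C q 1 n).
Local Notation L := (shiftmx C q 0 n).
Local Notation X := (invmx H).
Local Notation Rs z := ((Rmx q n z^*)^t*).

Lemma hankel_unit : H \in unitmx.
Proof. by case: s_posdef => /posdefmx_unit. Qed.

Lemma hankel_herm : H^t* = H.
Proof. by case: s_posdef => -[/hermsymmxP]. Qed.

Lemma shiftmx_resolvent x : S *m (1%:M - x *: T) = S - x *: L.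
Proof. by rewrite mulmxBr mulmx1 -scalemxAr shiftmx_Tmx. Qed.

Lemma Tmx_factor : T = S^t* *m L.
Proof.
rewrite -[LHS]mul1mx -vmx_shiftmx_decomp mulmxDl -!mulmxA vmx_adj_Tmx mulmx0.
by rewrite add0r shiftmx_Tmx.
Qed.

Lemma shiftmx_hankel d : (d <= 1)%N ->
  shiftmx C q d n *m H = hankel1 (fun k => s (d + k)%N) n.
Proof.
move=> le_d1; rewrite hankelE shiftmxM //.
by apply: eq_bmx => k l _ _; rewrite addnA.
Qed.

Lemma shiftmx_hankel_adj d e : (d <= 1)%N -> (e <= 1)%N ->
  shiftmx C q d n *m H *m (shiftmx C q e n)^t* =
  hankel (fun k => s (d + e + k)%N) n.
Proof.
move=> le_d1 le_e1; rewrite shiftmx_hankel // mulmx_shift_adj //.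
by rewrite hankelE; apply: eq_bmx => k l _ _; rewrite [(k + _)%N]addnCA !addnA.
Qed.

(** Splitting off the first block gives T H = - u_1 v' + S' (L H S') S. Taking adjoints gives H T'
    with S H L' in the middle; both middle terms are the Hankel matrix of s_{k+1} and cancel. *)
Lemma hankel_lyapunov :
  T *m H - H *m T^t* = v *m (T *m u)^t* - T *m u *m v^t*.
Proof.
have TH : T *m H = - (T *m u *m v^t*) + S^t* *m (L *m H *m S^t*) *m S.
  rewrite -[LHS]mulmx1 -vmx_shiftmx_decomp mulmxDr umxE mulmxN mulNmx opprK.
  by rewrite Tmx_factor !mulmxA.
have HT : H *m T^t* = - (v *m (T *m u)^t*) + S^t* *m (L *m H *m S^t*) *m S.
  rewrite -[H in LHS]hankel_herm -adjmxM TH adjmxD adjmxN !adjmxM !trmxCK.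
  rewrite hankel_herm [S *m (H *m _)]mulmxA.
  by rewrite !shiftmx_hankel_adj // !mulmxA.
by rewrite TH HT opprD opprK addrACA subrr addr0 addrC.
Qed.

Lemma hankel1_mom4 : (S - a *: L) *m H = hankel1 (mom4 a s) n.
Proof.
rewrite mulmxBl -scalemxAl !shiftmx_hankel //.
by apply/matrixP => i j; rewrite !mxE; ring.
Qed.

Lemma hankel1_mom3 : (S - b *: L) *m H = - hankel1 (mom3 b s) n.
Proof.
rewrite mulmxBl -scalemxAl !shiftmx_hankel //.
by apply/matrixP => i j; rewrite !mxE; ring.
Qed.

(** In terms of a measure in t, the congruence multiplies the weight by (t - x)(t - y). *)
Lemma hankel_congr x y : y^* = y ->
  (S - x *: L) *m H *m (S - y *: L)^t* =
  hankel (fun k => s k.+2 - (x + y) *: s k.+1 + (x * y) *: s k) n.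
Proof.
move=> y_real; rewrite adjmxB adjmxZ y_real !mulmxBr !mulmxBl.
rewrite -!scalemxAr -!scalemxAl !shiftmx_hankel_adj //.
by apply/matrixP => i j; rewrite !mxE; ring.
Qed.

(* (b - a)(x - a) = (x - a)^2 + (x - a)(b - x). *)
Lemma hankel_mom4_unit : hankel (mom4 a s) n \in unitmx.
Proof.
apply: (unitmx_congr_posdef (Y := S - a *: L) (k := b - a)
  s_posdef.1 s_posdef.2).
rewrite hankel_congr //.
by apply/matrixP => i j; rewrite !mxE; ring.
Qed.

(* (b - a)(b - x) = (b - x)^2 + (x - a)(b - x). *)
Lemma hankel_mom3_unit : hankel (mom3 b s) n \in unitmx.
Proof.
apply: (unitmx_congr_posdef (Y := S - b *: L) (k := b - a)
  s_posdef.1 s_posdef.2).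
rewrite hankel_congr //.
by apply/matrixP => i j; rewrite !mxE; ring.
Qed.

(** The hypothesis says y_{k+1} = x y_k, so y is a geometric progression determined by its first
    block. *)
Lemma shiftmx_ker x p (y : 'M_(_, p)) :
  (S - x *: L) *m y = 0 -> y = Rmx q n x *m v *m (v^t* *m y).
Proof.
move=> Sy0; have yE : (1%:M - x *: T) *m y = v *m (v^t* *m y).
  rewrite [LHS]vmx_shiftmx_split.
  rewrite [S *m _]mulmxA shiftmx_resolvent Sy0 mulmx0 addr0 mulmxBl mul1mx.
  by rewrite -scalemxAl mulmxBr -scalemxAr [_ *m (T *m y)]mulmxA vmx_adj_Tmx
     mul0mx scaler0 subr0.
by rewrite -mulmxA -yE mulKmx ?one_subZ_Tmx_unit.
Qed.

(** The column H Sigma is killed by S - x L, hence is such a progression with first block c. The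
    last block I of Sigma makes c injective. *)
Lemma Sigma_resolvent t x : hankel t n \in unitmx ->
  (exists c, (S - x *: L) *m H = c *: hankel1 t n) ->
  exists2 c, c \in unitmx & Sigma t n = X *m Rmx q n x *m v *m c.
Proof.
move=> t_unit [k SH].
have [c SigmaE] : exists c, Sigma t n = X *m Rmx q n x *m v *m c.
  exists (v^t* *m (H *m Sigma t n)).
  rewrite -!(mulmxA X) -shiftmx_ker ?mulKmx ?hankel_unit //.
  by rewrite mulmxA SH -scalemxAl hankel1_Sigma // scaler0.
exists c => //; apply: unitmx_inj_col => y cy0.
by apply: (@Sigma_inj _ _ t n); rewrite SigmaE -(mulmxA _ c) cy0 mulmx0.
Qed.


Lemma Sigma_mom4E : exists2 c, c \in unitmx &
  Sigma (mom4 a s) n = X *m Rmx q n a *m v *m c.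
Proof.
apply: Sigma_resolvent; first exact: hankel_mom4_unit.
by exists 1; rewrite scale1r hankel1_mom4.
Qed.

Lemma Sigma_mom3E : exists2 c, c \in unitmx &
  Sigma (mom3 b s) n = X *m Rmx q n b *m v *m c.
Proof.
apply: Sigma_resolvent; first exact: hankel_mom3_unit.
by exists (-1); rewrite scaleN1r hankel1_mom3.
Qed.

(* A vector in the kernel of P3(a)^* gives Sigma x = (S - a L)^* g, and then
   0 = (S - b L) H Sigma x = - H_2 g. *)
Lemma P3_adj_unit : (P3 b s n a)^t* \in unitmx.
Proof.
apply: unitmx_inj_col => x; rewrite !adjmxM trmxCK => Px0.
apply: (@Sigma_inj _ _ (mom3 b s) n).
pose w := (Rmx q n a)^t* *m (Sigma (mom3 b s) n *m x).
(* This is the kernel assumption; it leaves w = S' S w, the source of g = S w. *)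
have vw0 : v^t* *m w = 0 by rewrite /w -Px0 !mulmxA.
have wE : Sigma (mom3 b s) n *m x = (1%:M - a *: T)^t* *m w.
  by rewrite /w adjmxV mulKVmx // unitmx_adj one_subZ_Tmx_unit.
have SigmaE : Sigma (mom3 b s) n *m x = (S - a *: L)^t* *m (S *m w).
  rewrite wE [w in LHS]vmx_shiftmx_split vw0 mulmx0 add0r mulmxA -adjmxM.
  by rewrite shiftmx_resolvent.
have := congr1 (mulmx ((S - b *: L) *m H)) SigmaE.
rewrite hankel1_mom3 mulNmx [hankel1 _ _ *m _]mulmxA hankel1_Sigma;
  last exact: hankel_mom3_unit.
rewrite mul0mx oppr0 -hankel1_mom3 mulmxA hankel_congr //.
have -> : hankel (fun k => s k.+2 - (b + a) *: s k.+1 + (b * a) *: s k) n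
          = - hankel (mom2 a b s) n.
  by apply/matrixP => i j; rewrite !mxE; ring.
move=> /esym/(congr1 (mulmx (invmx (- hankel (mom2 a b s) n)))).
rewrite mulKmx; last by
  rewrite -scaleN1r unitmxZ ?unitrN1 // (posdefmx_unit s_posdef.2).
by rewrite mulmx0 SigmaE => ->; rewrite mulmx0.
Qed.

(** * The adjoints of P and Q in terms of the blocks of V~_1 *)

Local Notation A z := (VA H T v u z).
Local Notation B z := (VB H T v z).
Local Notation D z := (VD H T v u z).
Local Notation E z := (VC H T u z).

Lemma Gamma_denE x : x^* = x -> Gamma_den s n x = A x.
Proof. by move=> x_real; rewrite /Gamma_den /VA x_real. Qed.

Lemma V1tildeE z : V1tilde s n z = block_mx (A z) (B z) (E z) (D z).
Proof. by []. Qed.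

Lemma VA_Gamma x : x^* = x -> Gamma_den s n x \in unitmx ->
  A x *m (x *: Gamma s n x) = - B x.
Proof.
move=> x_real den_unit; rewrite /VB x_real opprK -scalemxAr.
rewrite -(Gamma_denE x_real).
by rewrite /Gamma mulKVmx.
Qed.

(** Cancel A(x) on the left in A B' = B A', using A M_x = - B. *)
Lemma VB_adj_Gamma x : x^* = x -> Gamma_den s n x \in unitmx ->
  (B x)^t* = - (x *: Gamma s n x *m (A x)^t*).
Proof.
move=> x_real den_unit; apply: (can_inj (mulKmx den_unit)).
rewrite (Gamma_denE x_real) (VA_VB_adj hankel_unit hankel_herm) //.
- by rewrite mulmxN mulmxA VA_Gamma // mulNmx opprK.
- by move=> z; apply: one_subZ_Tmx_unit.
- exact: hankel_lyapunov.
Qed.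

Lemma P_adjE t x z c : x^* = x -> Gamma_den s n x \in unitmx ->
  Sigma t n = X *m Rmx q n x *m v *m c ->
  (z - x) *: ((Sigma t n)^t* *m Rmx q n z^* *m v)^t* =
  - ((A z *m (x *: Gamma s n x) + B z) *m (A x)^t* *m c).
Proof.
move=> x_real den_unit ->; rewrite !adjmxM !trmxCK !mulmxA scalemxAl.
rewrite (christoffel_darboux_v (u := u) hankel_unit hankel_herm) //.
- rewrite VB_adj_Gamma // mulmxN mulmxA -opprD mulNmx.
  by rewrite [(_ + B z) *m _]mulmxDl.
- by move=> w; apply: one_subZ_Tmx_unit.
- exact: hankel_lyapunov.
Qed.

Lemma Q_adjE t x z c : x^* = x -> Gamma_den s n x \in unitmx ->
  Sigma t n = X *m Rmx q n x *m v *m c ->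
  ((Sigma t n)^t* *m Rmx q n z^* *m ((1%:M - x *: T) *m u))^t* =
  - ((E z *m (x *: Gamma s n x) + D z) *m (A x)^t* *m c).
Proof.
move=> x_real den_unit ->; rewrite adjmxM [(_ *m Rmx q n z^*)^t*]adjmxM !trmxCK.
rewrite !mulmxA.
rewrite (christoffel_darboux_u hankel_unit hankel_herm) //.
- rewrite VB_adj_Gamma // mulmxN mulmxA -opprD mulNmx.
  by rewrite [(_ + D z) *m _]mulmxDl.
- by move=> w; apply: one_subZ_Tmx_unit.
- exact: vmx_adj_vmx.
- exact: vmx_adj_Tmx.
- exact: umxE.
- exact: hankel_lyapunov.
Qed.

(** * Comparison of the two resolvent matrices *)

Hypothesis a_unit : Gamma_den s n a \in unitmx.
Hypothesis b_unit : Gamma_den s n b \in unitmx.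

Local Notation Ma := (a *: Gamma s n a).
Local Notation Mb := (b *: Gamma s n b).

Lemma Vmx_blocks z : let N := Nmx a b s n in
  Jmx *m Vmx a b s n z *m Jmx =
  block_mx (E z *m Ma + D z) (E z + (E z *m Ma + D z) *m N)
           (A z *m Ma + B z) (A z + (A z *m Ma + B z) *m N).
Proof.
rewrite /Jmx /Vmx /Mmx V1tildeE !mulmx_block.
by rewrite !(mulmx0, mul0mx, mulmx1, mul1mx, add0r, addr0).
Qed.

Lemma Umx_Vmx z :
  Umx a b s n z = Jmx *m Vmx a b s n z *m Jmx *m Dmx a s n.
Proof.
have [c4 c4_unit S4] := Sigma_mom4E; have [c3 c3_unit S3] := Sigma_mom3E.
have Aa_unit : (A a)^t* \in unitmx by rewrite unitmx_adj -Gamma_denE.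
have A_unit : A a \in unitmx by rewrite -Gamma_denE.
have Ab_unit : (A b)^t* \in unitmx by rewrite unitmx_adj -Gamma_denE.
have Q4E w : (Q4 a s n w^*)^t* = - ((E w *m Ma + D w) *m (A a)^t* *m c4).
  exact: Q_adjE.
have P4E w : (w - a) *: (P4 a s n w^*)^t*
             = - ((A w *m Ma + B w) *m (A a)^t* *m c4).
  exact: P_adjE.
have Q3E w : (Q3 b s n w^*)^t* = (E w *m Mb + D w) *m (A b)^t* *m c3.
  by rewrite /Q3 /u3mx mulmxN adjmxN (Q_adjE _ _ _ S3) // opprK.
have P3E w : (w - b) *: (P3 b s n w^*)^t*
             = - ((A w *m Mb + B w) *m (A b)^t* *m c3).
  exact: P_adjE.
(* The symplectic relation at a says (C M_a + D) A(a)' = I. *)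
have Q4a : (Q4 a s n a)^t* = - c4.
  have := Q4E a; rewrite a_real => ->.
  have := VD_VA_adj hankel_unit hankel_herm (one_subZ_Tmx_unit q n)
    hankel_lyapunov a_real.
  rewrite VB_adj_Gamma // mulmxN mulmxA -opprD -mulmxDl => /oppr_inj ->.
  by rewrite mul1mx.
have Q40 : (Q4 a s n 0)^t* = - ((A a)^t* *m c4).
  have := Q4E 0; rewrite conjC0 => ->.
  rewrite /VC /VD !scale0r mul0mx add0r subr0.
  by rewrite mul1mx.
have dE : dmx a s n = (A a)^t*.
  by rewrite /dmx Q40 Q4a -mulmxN mulmxK // -scaleN1r unitmxZ ?unitrN1.
pose G := Mb - Ma.
have P3a : (b - a) *: (P3 b s n a)^t* = A a *m G *m (A b)^t* *m c3.
  have := P3E a; rewrite a_real -opprB scaleNr => /oppr_inj ->.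
  by rewrite -[B a]opprK -VA_Gamma // -mulmxBr.
have ba_unit : b - a \is a GRing.unit by rewrite unitfE subr_eq0 gt_eqF.
(* G is a factor of an invertible product, so [Nmx] is its true inverse and not the default value of
   [invmx]. *)
have G_unit : G \in unitmx.
  have := P3_adj_unit; rewrite -(unitmxZ _ ba_unit) P3a !unitmx_mul.
  by case/andP=> /andP[/andP[]].
rewrite Vmx_blocks /Dmx dE trmxCK mulmx_block !mulmx0 !addr0 !add0r.
rewrite /Umx Q4a.
have col4 (M : 'M_q) : - (M *m (A a)^t* *m c4) *m invmx (- c4) = M *m (A a)^t*.
  by rewrite -mulmxN mulmxK // -scaleN1r unitmxZ ?unitrN1.
have col3 (e f : 'M_q) : (b - a)^-1 *: ((e *m Mb + f) *m (A b)^t* *m c3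
      *m invmx ((P3 b s n a)^t*)) =
    (e + (e *m Ma + f) *m Nmx a b s n) *m invmx (A a).
  (* After multiplication by P3(a)', the factors A(a)^{-1} and N meet A(a) G, and the column for M_a
     turns into the one for M_b. *)
  apply: (can_inj (mulmxK P3_adj_unit)); rewrite -scalemxAl.
  rewrite mulmxKV ?P3_adj_unit //.
  have -> : (P3 b s n a)^t* = (b - a)^-1 *: (A a *m G *m (A b)^t* *m c3).
    by rewrite -P3a scalerA mulVr // scale1r.
  rewrite -[RHS]scalemxAr; congr (_ *: _).
  rewrite -![_ *m (A b)^t* *m c3]mulmxA.
  exact/esym/mulmx_column_shift.
congr block_mx.
- by rewrite Q4E col4.
- by rewrite Q3E col3.
- by rewrite scalemxAl P4E col4.
- rewrite mulrC -scalerA scalemxAl -[b - z]opprB scaleNr P3E opprK.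
  exact: col3.
Qed.

End Resolvent.

Local Open Scope complex_scope.

Theorem theorem4p18 (R : realType) (a b : R) (q n : nat)
    (s : nat -> 'M[R[i]]_q)
    (hab : a < b) (hq : (0 < q)%N) (hn : (0 < n)%N)
    (hs : forall k : nat, (k <= 2 * n)%N -> s k \is hermsymmx)
    (hpos : hausdorff_posdef a%:C b%:C s n)
    (* I + a v_n^* R_n^*(a) H_{1,n}^{-1} u_{1,n} is invertible *)
    (ha : Gamma_den s n a%:C \in unitmx)
    (* Gamma_b, which occurs in the definition of V^(2n), exists *)
    (hb : Gamma_den s n b%:C \in unitmx) :
  forall z : R[i],
    Umx a%:C b%:C s n z =
      Jmx *m Vmx a%:C b%:C s n z *m Jmx *m Dmx a%:C s n.
Proof.
by move=> z; apply: Umx_Vmx => //; [rewrite ltcR | exact: conjc_real ..].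
Qed.
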